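(* Let $r\ge 1$, let $a_1,\dots,a_r,b_1,\dots,b_r$ be positive integers, let $q\in\mathbb{C}$ with $|q|<1$, and let $y\in\mathbb{C}$. Then for all $n\ge 0$, $$\left\langle \frac{e^{yt}-1}{t}\;\Big|\;E_{n,q}(x\mid a_1,\dots,a_r;b_1,\dots,b_r)\right\rangle=\int_0^yE_{n,q}(u\mid a_1,\dots,a_r;b_1,\dots,b_r)\,du.$$
   Context: The multivariate $q$-Euler polynomials $E_{n,q}(x\mid a_1,\dots,a_r;b_1,\dots,b_r)$ are defined by the generating function $$\sum_{n=0}^{\infty}E_{n,q}(x\mid a_1,\dots,a_r;b_1,\dots,b_r)\frac{t^n}{n!}=\frac{2^r}{(q^{b_1}e^{a_1t}+1)\cdots(q^{b_r}e^{a_rt}+1)}e^{xt}.$$ Each formal power series $f(t)=\sum_{k\ge0}c_k\frac{t^k}{k!}$ with $c_k\in\mathbb{C}$ is identified with the linear functional $p(x)\mapsto\langle f(t)\mid p(x)\rangle$ on $\mathbb{C}[x]$ determined by $\langle f(t)\mid x^n\rangle=c_n$ for all $n\ge0$; in particular $\langle t^k\mid x^n\rangle=n!\,\delta_{n,k}$. Here $\frac{e^{yt}-1}{t}$ denotes the formal power series $\sum_{j\ge1}\frac{y^j}{j!}t^{j-1}$. The integral of a polynomial between complex limits is the difference of the values of a polynomial antiderivative. *)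

(* Defs.v *)
From HB Require Import structures.
From mathcomp Require Import all_boot all_order all_algebra.
From mathcomp Require Import ring boolp reals.
From mathcomp Require Export complex.

Set Implicit Arguments.
Unset Strict Implicit.
Unset Printing Implicit Defensive.

Import Order.TTheory GRing.Theory Num.Theory.
Local Open Scope ring_scope.

(* Formal power series in one variable t: [f n] is the ordinary coefficient   *)
(* of t^n in [f], so that f = \sum_k c_k t^k / k! when c_k = f k * k!.         *)
Record fps (A : Type) := Fps { fps_coef :> nat -> A }.

Lemma fpsP (A : Type) (f g : fps A) : f =1 g -> f = g.
Proof. by case: f g => f [g] /= /funext ->. Qed.

HB.instance Definition _ (A : Type) := gen_eqMixin (fps A).
HB.instance Definition _ (A : Type) := gen_choiceMixin (fps A).

Section FpsRing.
Variable A : comNzRingType.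
Implicit Types f g h : fps A.

Definition fps_zero : fps A := Fps (fun=> 0).
Definition fps_opp f : fps A := Fps (fun n => - f n).
Definition fps_add f g : fps A := Fps (fun n => f n + g n).
Definition fpsC (c : A) : fps A := Fps (fun n => if n == 0%N then c else 0).
Definition fpsX : fps A := Fps (fun n => (n == 1%N)%:R).
Definition fps_mul f g : fps A :=
  Fps (fun n => \sum_(i < n.+1) f i * g (n - i)%N).

Fact fps_addA : associative fps_add.
Proof. by move=> f g h; apply: fpsP => n /=; rewrite addrA. Qed.
Fact fps_addC : commutative fps_add.
Proof. by move=> f g; apply: fpsP => n /=; rewrite addrC. Qed.
Fact fps_add0 : left_id fps_zero fps_add.
Proof. by move=> f; apply: fpsP => n /=; rewrite add0r. Qed.
Fact fps_addN : left_inverse fps_zero fps_opp fps_add.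
Proof. by move=> f; apply: fpsP => n /=; rewrite addNr. Qed.

HB.instance Definition _ :=
  GRing.isZmodule.Build (fps A) fps_addA fps_addC fps_add0 fps_addN.

Let trunc n f : {poly A} := \poly_(i < n) f i.

Let fps_mul_trunc n i f g : (i < n)%N ->
  fps_mul f g i = (trunc n f * trunc n g)`_i.
Proof.
move=> lt_in; rewrite coefM /=; apply: eq_bigr => j _.
rewrite !coef_poly (leq_ltn_trans _ lt_in) ?leq_ord //.
by rewrite (leq_ltn_trans (leq_subr _ _) lt_in).
Qed.

Let trunc_mul n i (p : {poly A}) f g : (i < n)%N ->
  (trunc n (fps_mul f g) * p)`_i = (trunc n f * trunc n g * p)`_i.
Proof.
move=> lt_in; rewrite !coefM; apply: eq_bigr => j _; congr (_ * _).
have lt_jn : (j < n)%N by rewrite (leq_ltn_trans _ lt_in) ?leq_ord.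
by rewrite coef_poly lt_jn (fps_mul_trunc _ _ lt_jn).
Qed.

Fact fps_mulC : commutative fps_mul.
Proof.
by move=> f g; apply: fpsP => n; rewrite !(fps_mul_trunc _ _ (ltnSn n)) mulrC.
Qed.

Fact fps_mulA : associative fps_mul.
Proof.
move=> f g h; apply: fpsP => n; rewrite !(fps_mul_trunc _ _ (ltnSn n)).
by rewrite mulrC !trunc_mul // mulrC mulrA.
Qed.

Fact fps_mul1 : left_id (fpsC 1) fps_mul.
Proof.
move=> f; apply: fpsP => n /=; rewrite big_ord_recl /= subn0 mul1r big1 ?addr0 //.
by move=> i _; rewrite mul0r.
Qed.

Fact fps_mulDl : left_distributive fps_mul fps_add.
Proof.
move=> f g h; apply: fpsP => n /=; rewrite -big_split /=.
by apply: eq_bigr => i _; rewrite mulrDl.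
Qed.

Fact fps_1neq0 : fpsC 1 != 0.
Proof. by apply/eqP => /(congr1 (fun f : fps A => f 0%N)) /eqP; rewrite oner_eq0. Qed.

HB.instance Definition _ := GRing.Zmodule_isComNzRing.Build (fps A)
  fps_mulA fps_mulC fps_mul1 fps_mulDl fps_1neq0.

Lemma fps_coefD f g n : (f + g) n = f n + g n. Proof. by []. Qed.
Lemma fps_coefB f g n : (f - g) n = f n - g n. Proof. by []. Qed.
Lemma fps_coef1 n : (1 : fps A) n = (n == 0%N)%:R. Proof. by case: n. Qed.
Lemma fps_coefM f g n : (f * g) n = \sum_(i < n.+1) f i * g (n - i)%N.
Proof. by []. Qed.

Lemma fps_coef0M f g : (f * g) 0%N = f 0%N * g 0%N.
Proof. by rewrite fps_coefM big_ord1. Qed.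

Lemma fps_coefXM f n : (fpsX * f) n = if n is m.+1 then f m else 0.
Proof.
case: n => [|n]; first by rewrite fps_coef0M mul0r.
rewrite fps_coefM 2!big_ord_recl /= mul0r add0r mul1r subSS subn0 big1 ?addr0 //.
by move=> i _; rewrite mul0r.
Qed.

End FpsRing.

Arguments fpsX {A}.

Section FpsUnitRing.
Variable A : comUnitRingType.
Implicit Types f g : fps A.

Definition fps_unit : {pred fps A} := fun f => f 0%N \is a GRing.unit.

(* The first [n.+1] coefficients of the inverse of [f]. *)
Fixpoint fps_inv_seq f n : seq A :=
  if n is m.+1 then
    let s := fps_inv_seq f m in
    rcons s (- ((f 0%N)^-1 * \sum_(i < m.+1) f i.+1 * s`_(m - i)))
  else [:: (f 0%N)^-1].

Definition fps_inv f : fps A :=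
  if f \in fps_unit then Fps (fun n => (fps_inv_seq f n)`_n) else f.

Let size_inv_seq f n : size (fps_inv_seq f n) = n.+1.
Proof. by elim: n => //= n IHn; rewrite size_rcons IHn. Qed.

Let nth_inv_seq f n k : (k <= n)%N ->
  (fps_inv_seq f n)`_k = (fps_inv_seq f k)`_k.
Proof.
elim: n => [|n IHn]; first by rewrite leqn0 => /eqP->.
rewrite leq_eqVlt => /predU1P[-> //|]; rewrite ltnS => le_kn.
by rewrite /= nth_rcons size_inv_seq ltnS le_kn IHn.
Qed.

Fact fps_mulV : {in fps_unit, left_inverse 1 fps_inv *%R}.
Proof.
move=> f Uf; rewrite mulrC; apply: fpsP => n; rewrite fps_coef1 fps_coefM.
rewrite /fps_inv Uf; case: n => [|n]; first by rewrite big_ord1 /= divrr.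
rewrite big_ord_recl subn0 /= nth_rcons size_inv_seq ltnn eqxx mulrN mulVKr //.
apply/eqP; rewrite addrC subr_eq0; apply/eqP/eq_bigr => i _.
by rewrite subSS (nth_inv_seq _ (leq_subr i n)).
Qed.

Fact fps_unitPl f g : g * f = 1 -> f \in fps_unit.
Proof.
move=> gf1; apply/unitrPr; exists (g 0%N).
by rewrite mulrC -fps_coef0M gf1 fps_coef1.
Qed.

Fact fps_inv_out : {in [predC fps_unit], fps_inv =1 id}.
Proof. by move=> f /negbTE/= Uf; rewrite /fps_inv Uf. Qed.

HB.instance Definition _ := GRing.ComNzRing_hasMulInverse.Build (fps A)
  fps_mulV fps_unitPl fps_inv_out.

Lemma fps_unitE f : (f \is a GRing.unit) = (f 0%N \is a GRing.unit).
Proof. by []. Qed.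

(* \sum_n c_n t^n / n! *)
Definition fps_egf (c : nat -> A) : fps A := Fps (fun n => c n / (n`!)%:R).

(* e^(c t) *)
Definition fps_exp (c : A) : fps A := fps_egf (fun n => c ^+ n).

(* (e^(y t) - 1) / t; since t is not invertible this is not a quotient in     *)
(* [fps A], see [fps_expm1_divE].                                             *)
Definition fps_expm1_div (y : A) : fps A :=
  Fps (fun m => y ^+ m.+1 / (m.+1`!)%:R).

Lemma fps_expm1_divE y : fpsX * fps_expm1_div y = fps_exp y - 1.
Proof.
apply: fpsP => -[|n]; rewrite fps_coefXM fps_coefB fps_coef1 /=.
  by rewrite expr0 fact0 divr1 subrr.
by rewrite subr0.
Qed.

End FpsUnitRing.

Section Umbral.
Variable F : fieldType.
Implicit Types (f : fps F) (p P : {poly F}).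

(* <f | p>, the linear functional determined by <f | x^n> = c_n, where        *)
(* f = \sum_k c_k t^k / k!.                                                   *)
Definition umbral f p : F := \sum_(k < size p) p`_k * (f k * (k`!)%:R).

Let umbral_wide n f p : (size p <= n)%N ->
  umbral f p = \sum_(k < n) p`_k * (f k * (k`!)%:R).
Proof.
move=> le_pn; rewrite /umbral (big_ord_widen n (fun k => p`_k * (f k * (k`!)%:R))) //.
rewrite big_mkcond; apply: eq_bigr => k _; case: ltnP => // le_pk.
by rewrite nth_default // mul0r.
Qed.

Lemma umbral_linear f a p P : umbral f (a *: p + P) = a * umbral f p + umbral f P.
Proof.
pose n := maxn (size (a *: p + P)) (maxn (size p) (size P)).
rewrite !(@umbral_wide n) /n ?leq_max ?leqnn ?orbT // mulr_sumr -big_split /=.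
by apply: eq_bigr => k _; rewrite coefD coefZ mulrDl mulrA.
Qed.

Lemma umbralXn f n : umbral f 'X^n = f n * (n`!)%:R.
Proof.
rewrite /umbral size_polyXn big_ord_recr /= coefXn eqxx mul1r big1 ?add0r // => k _.
by rewrite coefXn ltn_eqF ?mul0r.
Qed.

Definition poly_primitive p : {poly F} :=
  \poly_(i < (size p).+1) (if i is j.+1 then p`_j / j.+1%:R else 0).

(* \int_a^b p(u) du *)
Definition poly_integral p (a b : F) : F :=
  (poly_primitive p).[b] - (poly_primitive p).[a].

End Umbral.

Section NumField.
Variable F : numFieldType.
Implicit Types (f : fps F) (p P : {poly F}).

Lemma umbral_egf (c : nat -> F) n : umbral (fps_egf c) 'X^n = c n.
Proof. by rewrite umbralXn /= divfK // pnatr_eq0 -lt0n fact_gt0. Qed.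

Lemma deriv_poly_primitive p : (poly_primitive p)^`() = p.
Proof.
apply/polyP => i; rewrite coef_deriv coef_poly ltnS.
case: ltnP => [_|le_pi]; last by rewrite mul0rn nth_default.
by rewrite -[LHS]mulr_natr divfK // pnatr_eq0.
Qed.

Lemma poly_integralE p P a b : P^`() = p -> poly_integral p a b = P.[b] - P.[a].
Proof.
move=> dP; have /size1_polyC D : (size (poly_primitive p - P)%R <= 1)%N.
  apply/leq_sizeP => -[//|j] _; apply/eqP.
  have := congr1 (fun s : {poly F} => s`_j) (deriv_poly_primitive p).
  rewrite -dP !coef_deriv => /eqP; rewrite -subr_eq0 -mulrnBl mulrn_eq0 /=.
  by rewrite coefB.
by rewrite /poly_integral -(subrK P (poly_primitive p)) D !hornerE; ring.
Qed.

End NumField.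

Section QEuler.
Variable F : fieldType.
Variables (q : F) (r : nat) (a b : 'I_r -> nat).

(* (q^(b_1) e^(a_1 t) + 1) ... (q^(b_r) e^(a_r t) + 1), as a power series     *)
(* over F[x].                                                                 *)
Definition qEuler_den : fps {poly F} :=
  \prod_(i < r) (fpsC (q ^+ b i)%:P * fps_exp (a i)%:R + 1).

Definition qEuler_genfun : fps {poly F} := 2 ^+ r / qEuler_den * fps_exp 'X.

(* E_{n,q}(x | a_1, ..., a_r; b_1, ..., b_r) *)
Definition qEuler (n : nat) : {poly F} := (n`!)%:R * qEuler_genfun n.

End QEuler.

(* The inverse in [qEuler_genfun] is a genuine one in the intended range.     *)
Lemma qEuler_den_unit (F : numFieldType) (q : F) r (a b : 'I_r -> nat) :
  `|q| < 1 -> (forall i, 0 < b i)%N -> qEuler_den q a b \is a GRing.unit.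
Proof.
move=> q1 b_gt0; apply: rpred_prod => i _; rewrite fps_unitE fps_coefD fps_coef0M.
rewrite fps_coef1 /= expr0 fact0 divr1 mulr1 -polyCD poly_unitE size_polyC coefC /=.
suff nz : q ^+ b i + 1 != 0 by rewrite nz unitfE.
rewrite addr_eq0; apply/eqP => qb; have := congr1 Num.norm qb.
rewrite normrN1 normrX => /eqP; rewrite lt_eqF //.
by rewrite exprn_ilt1 // -lt0n.
Qed.

Lemma qEuler_egf (F : numFieldType) (q : F) r (a b : 'I_r -> nat) :
  `|q| < 1 -> (forall i, 0 < b i)%N ->
  fps_egf (qEuler q a b) * qEuler_den q a b = 2 ^+ r * fps_exp 'X.
Proof.
move=> q1 b_gt0; have -> : fps_egf (qEuler q a b) = qEuler_genfun q a b.
  apply: fpsP => n /=; rewrite mulrC mulKr // poly_unitE -polyC_natr.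
  by rewrite size_polyC coefC unitfE pnatr_eq0 -lt0n fact_gt0.
by rewrite /qEuler_genfun mulrAC divrK // qEuler_den_unit.
Qed.

(* Main.v *)
Require Import Defs.
From mathcomp Require Import all_boot all_order all_algebra.
From mathcomp Require Import reals complex.

Import GRing.Theory Num.Theory.
Local Open Scope ring_scope.

(** On every polynomial, the functional attached to (e^(y t) - 1) / t is
    integration from 0 to y.  The coefficient of t^k in that series is
    y^(k+1) / (k+1)!, so it sends x^k to k! y^(k+1) / (k+1)! = y^(k+1) / (k+1),
    which is the integral of x^k from 0 to y.  Weighting these equalities by the
    coefficients of p gives [umbral_expm1_div]; the theorem is its case where p
    is a q-Euler polynomial. *)

Lemma umbral_expm1_div (F : numFieldType) (y : F) (p : {poly F}) :
  umbral (fps_expm1_div y) p = poly_integral p 0 y.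
Proof.
rewrite /umbral /poly_integral /poly_primitive !horner_poly.
(* The primitive has no constant term, hence vanishes at 0. *)
rewrite !big_ord_recl /= !mul0r !add0r [X in _ - X]big1 ?subr0; last first.
  by move=> k _; rewrite expr0n mulr0.
apply: eq_bigr => k _; rewrite /= factS natrM invfM.
have fact_neq0 : (k`!)%:R != 0 :> F by rewrite pnatr_eq0 -lt0n fact_gt0.
by rewrite -!mulrA mulVf // mulr1 [y ^+ _ * _]mulrC.
Qed.

Theorem theorem4 (R : realType) (r : nat) (a b : 'I_r -> nat) (q y : R[i]) (n : nat)
    (r_gt0 : (0 < r)%N)
    (a_gt0 : forall i, (0 < a i)%N)
    (b_gt0 : forall i, (0 < b i)%N)
    (q_lt1 : `|q| < 1) :
  umbral (fps_expm1_div y) (qEuler q a b n) = poly_integral (qEuler q a b n) 0 y.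
Proof. exact: umbral_expm1_div. Qed.
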